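(* If $A$ and $B$ are disjoint bases of a matroid $M$, then there exist three elements in $A$ that can be serially and symmetrically exchanged with some three elements in $B$; that is, there exist distinct $a_1,a_2,a_3\in A$ and distinct $b_1,b_2,b_3\in B$ such that for each $i\in\{1,2,3\}$ both $(A\setminus\{a_1,\dots,a_i\})\cup\{b_1,\dots,b_i\}$ and $(B\setminus\{b_1,\dots,b_i\})\cup\{a_1,\dots,a_i\}$ are bases of $M$.
   Context: Matroids have a finite ground set. A serial symmetric basis-exchange between two bases is performed by exchanging one element of the first basis with one element of the second at a time, so that after each single exchange both resulting sets are bases.
   Formalization: The bases are assumed to have at least three elements (rank at least 3); without this the claim fails, since a basis with fewer than three elements does not contain three distinct elements. *)

(* Defs.v *)
From HB Require Import structures.
From mathcomp Require Import all_boot.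

Set Implicit Arguments.
Unset Strict Implicit.
Unset Printing Implicit Defensive.

(* The ground set is the whole finite type T. *)
Record matroid (T : finType) := Matroid {
  indep : pred {set T};
  indep0 : indep set0;
  indepS : forall I J : {set T}, I \subset J -> indep J -> indep I;
  indep_aug : forall I J : {set T}, indep I -> indep J -> #|I| < #|J| ->
    exists2 x, x \in J :\: I & indep (x |: I)
}.

Definition basis (T : finType) (M : matroid T) (B : {set T}) : bool :=
  maxset (indep M) B.

(* Main.v *)
Require Import Defs.
From HB Require Import structures.
From mathcomp Require Import all_boot zify.

Set Implicit Arguments.
Unset Strict Implicit.
Unset Printing Implicit Defensive.

(** Suppose that no three serial exchanges exist.  Two serial exchanges always do;
    let X = {x1, x2, a} in A contain the two exchanged elements x1, x2.  The triples
    S for which both A \ X + S and B + X \ S are bases are the common bases of two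
    matroids of rank 3 on X + B.  The symmetric exchange property, applied after two
    exchanges, can only undo part of them, and this becomes a purely local
    condition ([stuck]) on the two rank-3 matroids.  A case analysis of points and
    lines shows that under this condition no triple of B is a common basis.  But
    the multiple symmetric exchange property, obtained from matroid intersection,
    provides a triple Y in B such that A \ X + Y and B \ Y + X are bases. *)

(** * Matroid intersection *)

Section RankFunctions.
Variable T : finType.
Implicit Types (f g : {set T} -> nat) (x e : T) (E I S U V : {set T}).

Lemma set_ind (P : {set T} -> Prop) :
    P set0 -> (forall x S, x \notin S -> P S -> P (x |: S)) ->
  forall S, P S.
Proof.
move=> P0 PU S; elim: {S}#|S| {-2}S (leqnn #|S|) => [|n ih] S.
  by rewrite leqn0 cards_eq0 => /eqP ->.
have [-> //|[x xS]] := set_0Vmem S; rewrite (cardsD1 x) xS ltnS => /ih PD.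
by rewrite -(setD1K xS); apply: PU; rewrite ?setD11.
Qed.

(** Matroids enter the intersection theorem through their rank functions, since contraction of a
    nonloop [e] is then just [f (e |: S) - 1]. Monotonicity comes from the unit-increase clause. *)
Definition rank_function f : Prop :=
  [/\ f set0 = 0,
      forall S x, f S <= f (x |: S) <= (f S).+1
    & forall S U, f (S :|: U) + f (S :&: U) <= f S + f U].

Lemma rank_function_mono f S U : rank_function f -> S \subset U -> f S <= f U.
Proof.
move=> [f0 fU fS] /setUidPr <-.
elim/set_ind: U => [|x U _ ih]; first by rewrite setU0.
by rewrite setUCA; have := fU (S :|: U) x; lia.
Qed.

Lemma rank_function_loop f e S : rank_function f -> f [set e] = 0 ->
  f (e |: S) = f S.
Proof.
by move=> [f0 fU fS] fe; have := fS [set e] S; have := fU S e; lia.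
Qed.

Lemma rank_function_contract f e : rank_function f -> f [set e] = 1 ->
  rank_function (fun S => f (e |: S) - 1).
Proof.
move=> F fe; have [f0 fU fS] := F.
have f_gt0 S : 0 < f (e |: S).
  by rewrite -fe; apply: rank_function_mono; rewrite // subsetUl.
split=> [|S x|S U]; first by rewrite setU0 fe.
  by have := fU (e |: S) x; rewrite setUCA; have := f_gt0 S; lia.
have := fS (e |: S) (e |: U); rewrite -setUUr -setUIr.
by move: (f_gt0 S) (f_gt0 U) (f_gt0 (S :|: U)) (f_gt0 (S :&: U)); lia.
Qed.

(* The hard half of Edmonds' matroid intersection theorem.  If neither deleting
   nor contracting [e] preserves the hypothesis, the two violating sets combine
   by submodularity into a violation of the original hypothesis. *)
Lemma matroid_intersection f g E k :
    rank_function f -> rank_function g ->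
    (forall U, U \subset E -> k <= f U + g (E :\: U)) ->
  exists I, [/\ I \subset E, #|I| = k, f I = k & g I = k].
Proof.
elim/set_ind: E f g k => [|e E eE ih] f g k F G kE;
  have [f0 fU fS] := F; have [g0 gU gS] := G.
  have := kE set0 (sub0set _); rewrite setD0 f0 g0 leqn0 => /eqP k0.
  by exists set0; rewrite cards0 f0 g0 k0; split.
have [k0|k_gt0] := posnP k.
  by exists set0; rewrite sub0set cards0 f0 g0 k0; split.
have [delE|] := boolP [forall U : {set T}, (U \subset E) ==> (k <= f U + g (E :\: U))].
  have [U UE|I [IE cI fI gI]] := ih f g k F G.
    exact: (implyP (forallP delE U)).
  by exists I; split=> //; apply: subset_trans IE (subsetUr _ _).
rewrite negb_forall => /existsP[U]; rewrite negb_imply => /andP[UE]; rewrite -ltnNge => ltU.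
have eU : e \notin U by apply: contra eE => /(subsetP UE).
have DU : (e |: E) :\: U = e |: (E :\: U).
  by apply/setP=> x; rewrite !inE; case: eqP => [->|]; rewrite ?eU ?andbT.
have DeU : (e |: E) :\: (e |: U) = E :\: U.
  by apply/setP=> x; rewrite !inE; case: eqP => [->|] //=; rewrite (negbTE eE) andbF.
(* If [e] were a loop of [f], it could be added to the violating set [U] at no cost, contradicting
   [kE]. For [g], a loop could be added to the complement of [U]. *)
have fe : f [set e] = 1.
  have := fU set0 e; rewrite setU0 f0; case: (posnP (f [set e])) => [fe0|]; last lia.
  by have := kE (e |: U) (setUS _ UE); rewrite DeU (rank_function_loop _ F fe0); lia.
have ge : g [set e] = 1.
  have := gU set0 e; rewrite setU0 g0; case: (posnP (g [set e])) => [ge0|]; last lia.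
  have := kE U (subset_trans UE (subsetUr _ _)).
  by rewrite DU (rank_function_loop _ G ge0); lia.
have f_gt0 S : 0 < f (e |: S).
  by rewrite -fe; apply: rank_function_mono; rewrite // subsetUl.
have g_gt0 S : 0 < g (e |: S).
  by rewrite -ge; apply: rank_function_mono; rewrite // subsetUl.
have [V VE|I [IE cI fI gI]] := ih _ _ k.-1 (rank_function_contract F fe) (rank_function_contract G ge).
  have eV : e \notin V by apply: contra eE => /(subsetP VE).
  have UVE : U :|: V \subset E by rewrite subUset UE.
  have := kE (e |: (U :|: V)) (setUS _ UVE).
  have := kE (U :&: V) (subset_trans (subset_trans (subsetIl _ _) UE) (subsetUr _ _)).
  have := fS U (e |: V); have := gS (E :\: U) (e |: (E :\: V)).
  have -> : U :|: (e |: V) = e |: (U :|: V) by rewrite setUCA.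
  have -> : U :&: (e |: V) = U :&: V.
    by apply/setP=> x; rewrite !inE; case: eqP => [->|] //=; rewrite (negbTE eU).
  have -> : (E :\: U) :|: (e |: (E :\: V)) = (e |: E) :\: (U :&: V).
    apply/setP=> x; rewrite !inE; case: eqP => [->|]; first by rewrite (negbTE eU) orbT.
    by move=> _; case: (x \in U); case: (x \in V); case: (x \in E).
  have -> : (E :\: U) :&: (e |: (E :\: V)) = (e |: E) :\: (e |: (U :|: V)).
    apply/setP=> x; rewrite !inE; case: eqP => [->|] /=; first by rewrite (negbTE eE) !andbF.
    by move=> _; case: (x \in U); case: (x \in V); case: (x \in E).
  by have := f_gt0 V; have := g_gt0 (E :\: V); lia.
exists (e |: I); split; first exact: setUS.
- by rewrite cardsU1 cI; have -> : e \notin I by [apply: contra eE => /(subsetP IE)]; lia.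
- by have := f_gt0 I; lia.
- by have := g_gt0 I; lia.
Qed.
End RankFunctions.

(** * Ranks and multiple symmetric exchange *)

Section Rank.
Variables (T : finType) (M : matroid T).
Implicit Types (A B I J S U X Y : {set T}) (x : T).

Definition mrank S : nat := \max_(I : {set T} | (I \subset S) && indep M I) #|I|.

Lemma indep_rank I S : I \subset S -> indep M I -> #|I| <= mrank S.
Proof. by move=> IS iI; apply: leq_bigmax_cond; rewrite IS. Qed.

Lemma extend_indep I S : I \subset S -> indep M I ->
  exists J, [/\ I \subset J, J \subset S, indep M J & #|J| = mrank S].
Proof.
move=> IS iI.
pose P J := [&& I \subset J, J \subset S & indep M J].
have PI : P I by rewrite /P subxx IS.
case: (arg_maxnP (fun J : {set T} => #|J|) PI) => J /and3P[IJ JS iJ] maxJ.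
exists J; split=> //; apply/eqP; rewrite eqn_leq indep_rank //= leqNgt; apply/negP=> ltJ.
have cP : 0 < #|[pred K : {set T} | (K \subset S) && indep M K]|.
  by apply/card_gt0P; exists I; rewrite inE IS.
have [K] := eq_bigmax_cond (fun K : {set T} => #|K|) cP.
rewrite inE => /andP[KS iK] eK.
have {}ltJ : #|J| < #|K|.
  by rewrite -eK; congr (_ < _): ltJ; apply: eq_bigl => L; rewrite inE.
have [x xKJ ixJ] := indep_aug iJ iK ltJ; move: xKJ; rewrite inE => /andP[xJ xK].
suff /maxJ : P (x |: J) by rewrite /= cardsU1 xJ add1n ltnn.
apply/and3P; split=> //.
  by apply: subset_trans IJ (subsetUr _ _).
by rewrite subUset sub1set (subsetP KS).
Qed.

Lemma mrank_function : rank_function mrank.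
Proof.
split=> [|S x|S U].
- have [J [_ J0 _ <-]] := extend_indep (sub0set set0) (indep0 M).
  by move: J0; rewrite subset0 => /eqP ->; rewrite cards0.
- have [J [_ JS iJ cJ]] := extend_indep (sub0set S) (indep0 M).
  have [K [_ KS iK cK]] := extend_indep (sub0set (x |: S)) (indep0 M).
  apply/andP; split.
    by rewrite -cJ; apply: indep_rank => //; apply: subset_trans JS (subsetUr _ _).
  rewrite -cK; apply: leq_trans (_ : #|K :\ x|.+1 <= _).
    by rewrite (cardsD1 x K); case: (x \in K).
  by rewrite ltnS indep_rank ?subDset // (indepS (subsetDl K [set x])).
(* Submodularity: a maximal independent set [I] of the intersection is extended to one, [J], of the
   union. Then [J :&: S] and [J :&: U] are independent and both contain [I]. *)
have [I [_ IS iI <-]] := extend_indep (sub0set (S :&: U)) (indep0 M).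
have ISU : I \subset S :|: U by apply: subset_trans IS _; rewrite subIset // subsetUl.
have [J [IJ JS iJ <-]] := extend_indep ISU iI.
have jS : #|J :&: S| <= mrank S by apply: indep_rank; rewrite ?subsetIr // (indepS (subsetIl _ _)).
have jU : #|J :&: U| <= mrank U by apply: indep_rank; rewrite ?subsetIr // (indepS (subsetIl _ _)).
apply: leq_trans (leq_add jS jU).
rewrite -(cardsUI (J :&: S)) -setIUr (setIidPl JS) leq_add2l subset_leq_card //.
rewrite -setIIr subsetI IJ; exact: IS.
Qed.

Lemma indep_of_rank I : #|I| <= mrank I -> indep M I.
Proof.
move=> cI; have [J [_ JI iJ cJ]] := extend_indep (sub0set I) (indep0 M).
by have /eqP <- : J == I by rewrite eqEcard JI cJ.
Qed.

Lemma rank_indep I : indep M I -> mrank I = #|I|.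
Proof.
move=> iI; have [J [IJ JI _ <-]] := extend_indep (subxx I) iI.
by have -> : J = I by apply/eqP; rewrite eqEsubset IJ JI.
Qed.

Lemma basisE B : basis M B = indep M B && (#|B| == mrank setT).
Proof.
apply/maxsetP/andP=> [[iB maxB]|[iB /eqP cB]].
  have [J [BJ _ iJ cJ]] := extend_indep (subsetT B) iB.
  by rewrite -cJ (maxB J iJ BJ).
split=> // C iC BC; apply/eqP; rewrite eq_sym eqEcard BC cB.
by rewrite indep_rank ?subsetT.
Qed.

Lemma basis_rank B : basis M B -> mrank B = #|B|.
Proof. by rewrite basisE => /andP[/rank_indep]. Qed.

Lemma card_basis A B : basis M A -> basis M B -> #|A| = #|B|.
Proof. by rewrite !basisE => /andP[_ /eqP ->] /andP[_ /eqP ->]. Qed.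

Lemma rank_le_card S : mrank S <= #|S|.
Proof.
by have [J [_ JS _ <-]] := extend_indep (sub0set S) (indep0 M); apply: subset_leq_card.
Qed.

Lemma rank_le_basis B S : basis M B -> mrank S <= #|B|.
Proof.
rewrite basisE => /andP[_ /eqP ->].
exact: rank_function_mono mrank_function (subsetT S).
Qed.

Lemma basis_of_rank A S : basis M A -> #|S| <= #|A| -> #|A| <= mrank S ->
  basis M S.
Proof.
rewrite !basisE => /andP[_ /eqP <-] SA AS.
have iS : indep M S by apply: indep_of_rank; apply: leq_trans AS.
by rewrite iS eqn_leq SA -(rank_indep iS).
Qed.

(** The set [Y] is found as a common independent set of size [#|X|] of two matroids on [B], one for
    each of the two required bases. *)
Lemma multiple_symmetric_exchange A B X :
    basis M A -> basis M B -> X \subset A ->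
  exists Y, [/\ Y \subset B, #|Y| = #|X|, basis M ((A :\: X) :|: Y)
              & basis M ((B :\: Y) :|: X)].
Proof.
move=> bA bB XA; have [r0 rU rS] := mrank_function; have rF := mrank_function.
have cAB := card_basis bA bB; have rA := basis_rank bA; have rB := basis_rank bB.
have cDX : #|A :\: X| + #|X| = #|A| by rewrite cardsD (setIidPr XA) subnK ?subset_leq_card.
have rDX : mrank (A :\: X) = #|A :\: X|.
  by apply: rank_indep; apply: indepS (subsetDl _ _) _; move: bA; rewrite basisE => /andP[].
(* [f] is the rank function of M / (A \ X); a subset S of B is independent for [g]
   if and only if (B \ S) + X spans M. *)
pose f S := mrank (S :|: (A :\: X)) - #|A :\: X|.
pose g S := #|S :&: B| + mrank ((B :\: S) :|: X) - #|B|.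
have f_ge S : #|A :\: X| <= mrank (S :|: (A :\: X)).
  by rewrite -rDX; apply: rank_function_mono; rewrite // subsetUr.
have F : rank_function f.
  split=> [|S x|S U]; first by rewrite /f set0U rDX subnn.
    by rewrite /f -setUA; have := rU (S :|: (A :\: X)) x; have := f_ge S; lia.
  have := rS (S :|: (A :\: X)) (U :|: (A :\: X)); rewrite -setUUl -setUIl /f.
  by have := f_ge S; have := f_ge U; have := f_ge (S :&: U); have := f_ge (S :|: U); lia.
have g_ge S : #|B| <= #|S :&: B| + mrank ((B :\: S) :|: X).
  rewrite -rB; apply: (leq_trans (n := mrank ((S :&: B) :|: ((B :\: S) :|: X)))).
    by apply: rank_function_mono; rewrite // setUA setIC setID subsetUl.
  by have := rS (S :&: B) ((B :\: S) :|: X); have := rank_le_card (S :&: B); lia.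
have G : rank_function g.
  split=> [|S x|S U].
  - by rewrite /g set0I cards0 setD0; have := rank_le_basis (B :|: X) bB; lia.
  - have [xBS|] := boolP (x \in B :\: S); last first.
      rewrite inE negb_and negbK => xBS.
      have -> : g (x |: S) = g S.
        have e : B :\: (x |: S) = B :\: S.
          apply/setP=> y; rewrite !inE; case: eqP => //= ->.
          by case: (x \in S) xBS => //= /negbTE ->.
        rewrite /g e; congr (#|pred_of_set _| + _ - _); apply/setP=> y; rewrite !inE.
        by case: eqP => //= ->; case: (x \in S) xBS => //= /negbTE ->.
      by rewrite leqnn leqnSn.
    have := rU ((B :\: (x |: S)) :|: X) x.
    have -> : x |: ((B :\: (x |: S)) :|: X) = (B :\: S) :|: X.
      apply/setP=> y; rewrite !inE negb_or.
      by case: eqP xBS => //= ->; rewrite inE => ->.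
    have := g_ge S; have := g_ge (x |: S); rewrite /g setIUl.
    move: xBS; rewrite inE => /andP[xS xB].
    have -> : [set x] :&: B = [set x] by apply/setIidPl; rewrite sub1set.
    by rewrite cardsU1 inE (negbTE xS) /=; lia.
  have := rS ((B :\: S) :|: X) ((B :\: U) :|: X).
  rewrite -setUUl -setDIr -setUIl -setDUr /g.
  have := cardsUI (S :&: B) (U :&: B); rewrite -setIUl -setIIl.
  by have := g_ge S; have := g_ge U; have := g_ge (S :&: U); have := g_ge (S :|: U); lia.
(* The intersection condition is submodularity of [mrank] at [U :|: (A :\: X)] and [U :|: X]: their
   union contains [A] and their intersection contains the independent set [U]. *)
have [U UB|Y [YB cY fY gY]] := @matroid_intersection _ f g B #|X| F G.
  have := rS (U :|: (A :\: X)) (U :|: X).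
  have := f_ge U; have := g_ge (B :\: U); rewrite /f /g setDDr setDv set0U (setIidPr UB).
  rewrite (setIidPl (subsetDl B U)) cardsD (setIidPr UB).
  have := subset_leq_card UB.
  have : mrank A <= mrank (U :|: (A :\: X) :|: (U :|: X)).
    apply: rank_function_mono => //; apply/subsetP=> x; rewrite !inE => ->.
    by case: (x \in X); rewrite ?orbT.
  have : mrank U <= mrank ((U :|: (A :\: X)) :&: (U :|: X)).
    by apply: rank_function_mono; rewrite // -setUIr subsetUl.
  rewrite (rank_indep (I := U)); first by lia.
  by apply: indepS UB _; move: bB; rewrite basisE => /andP[].
have YDX := (leq_card_setU Y (A :\: X)).1.
exists Y; split=> //.
  by rewrite setUC; apply: (basis_of_rank bA); move: fY (f_ge Y); rewrite /f; lia.
apply: (basis_of_rank bB).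
  by have := (leq_card_setU (B :\: Y) X).1; rewrite cardsD (setIidPr YB); have := subset_leq_card YB; lia.
move: gY (g_ge Y); rewrite /g (setIidPl YB); lia.
Qed.
End Rank.

(** * Pairs of matroids of rank 3 *)

(* [g p q r] says that {p, q, r} is a basis of a matroid of rank 3. *)
Record rank3_bases (T : Type) (g : T -> T -> T -> bool) : Prop := Rank3Bases {
  bases_sym12 : forall p q r, g p q r = g q p r;
  bases_sym23 : forall p q r, g p q r = g p r q;
  bases_diag : forall p r, g p p r = false;
  bases_exchange : forall p q r s t u, g p q r -> g s t u ->
    [\/ g s q r, g t q r | g u q r]
}.

Ltac permute E :=
  first [ assumption
        | rewrite (bases_sym12 E); assumption
        | rewrite (bases_sym23 E); assumption
        | rewrite (bases_sym12 E) (bases_sym23 E); assumption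
        | rewrite (bases_sym23 E) (bases_sym12 E); assumption
        | rewrite (bases_sym12 E) (bases_sym23 E) (bases_sym12 E); assumption ].

Ltac refute E h :=
  first [ by rewrite (bases_diag E) in h
        | by rewrite (bases_sym23 E) (bases_diag E) in h
        | by rewrite (bases_sym12 E) (bases_sym23 E) (bases_diag E) in h
        | exfalso; match goal with
            N : is_true (~~ _) |- _ => apply: (negP N); permute E
          end ].

(* [swap E p q r s t u] replaces [p] in the basis [p q r] by an element of the
   basis [s t u], and closes the cases that are refuted or are the goal. *)
Tactic Notation "swap" constr(E) constr(p) constr(q) constr(r)
    constr(s) constr(t) constr(u) :=
  let h := fresh "h" in
  destruct (@bases_exchange _ _ E p q r s t u
      ltac:(permute E) ltac:(permute E)) as [h|h|h];
  first [permute E | refute E h | idtac].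

(** * Points and lines in one rank-3 matroid *)

Section OneMatroid.
Variables (T : Type) (g : T -> T -> T -> bool).
Hypothesis E : rank3_bases g.

(** Both [r] and [r'] lie on the two lines [ki] and [ji], which meet only in the point [i]; so they
    are parallel, or one is a loop. *)
Lemma parallel_dependent {k i j r r' s} :
  g k i j -> ~~ g k i r -> ~~ g j i r -> ~~ g k i r' -> ~~ g j i r' ->
  ~~ g r r' s.
Proof.
move=> h n1 n2 n3 n4; apply/negP=> b.
swap E s r r' k i j.
- swap E j k i k r r'.
- swap E r i r' k i j.
- swap E k i j j r r'.
Qed.

(** The basis [r r' s] only witnesses that [r] and [r'] are independent. Hence they span the line
    [kj], and [y] lies off that line. *)
Lemma line_bases {k j y r r' s} :
  g k j y -> ~~ g k j r -> ~~ g k j r' -> g r r' s -> g y r r'.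
Proof.
move=> h n n' b; swap E s r r' k j y.
- swap E y k j k r r'.
- swap E y k j j r r'.
Qed.

Lemma line_dependent {k j y r r'} :
  g k j y -> ~~ g k j r -> ~~ g k j r' -> ~~ g k r r'.
Proof. by move=> h n n'; apply/negP=> b; swap E y k j k r r'. Qed.

End OneMatroid.

(** * Common bases of a stuck pair of rank-3 matroids *)

Section TwoMatroids.
Variables (T : finType) (B : {set T}).
Implicit Types (g : T -> T -> T -> bool) (i j k p q r s t w y z : T).

Definition common g1 g2 p q r := g1 p q r && g2 p q r.

Lemma common_sym12 g1 g2 p q r : rank3_bases g1 -> rank3_bases g2 ->
  common g1 g2 p q r = common g1 g2 q p r.
Proof. by move=> E1 E2; rewrite /common (bases_sym12 E1) (bases_sym12 E2). Qed.

Lemma common_sym23 g1 g2 p q r : rank3_bases g1 -> rank3_bases g2 ->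
  common g1 g2 p q r = common g1 g2 p r q.
Proof. by move=> E1 E2; rewrite /common (bases_sym23 E1) (bases_sym23 E2). Qed.

Lemma commonC g1 g2 p q r : common g2 g1 p q r = common g1 g2 p q r.
Proof. exact: andbC. Qed.

(* For {i, j, k} = X, [common g1 g2 k i p] says that p can be exchanged with j, and
   [common g1 g2 k p q] that {p, q} can be exchanged with {i, j}.  The premises thus
   describe a serial exchange of length two; the conclusions say that it has no
   third step, and that symmetric exchange partners of r in B and of k exist
   nevertheless. *)
Definition stuck g1 g2 k i j := forall p q, p \in B -> q \in B ->
  common g1 g2 k p q -> common g1 g2 k i p || common g1 g2 k j p ->
  [/\ forall r, r \in B -> ~~ common g1 g2 p q r,
      forall r, r \in B -> common g1 g2 k p r || common g1 g2 k q r
    & common g1 g2 i p q || common g1 g2 j p q].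

Lemma stuckC g1 g2 k i j : stuck g1 g2 k i j -> stuck g1 g2 k j i.
Proof.
move=> st p q pB qB kpq; rewrite orbC => act.
by have [? ?] := st p q pB qB kpq act; rewrite orbC.
Qed.

Lemma stuck_swap g1 g2 k i j : stuck g1 g2 k i j -> stuck g2 g1 k i j.
Proof.
move=> st p q pB qB; rewrite ![common g2 _ _ _ _]commonC => kpq act.
have [n h e] := st p q pB qB kpq act.
by split=> // r rB; rewrite ![common g2 _ _ _ _]commonC ?n ?h.
Qed.

(** If [g1 k z p] held, each triple that is not common would fail in one determined matroid, with
    [p] and [q] in opposite roles. Exchanges then force [w p q] to be common, and after [inact] also
    [k j w], which [inact] forbids. *)
Lemma engaged_nonadjacent g1 g2 k j z w p q :
    rank3_bases g1 -> rank3_bases g2 ->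
    common g1 g2 k j z -> common g1 g2 k z w -> common g1 g2 z p q ->
    common g1 g2 k w p -> common g1 g2 k w q ->
    ~~ common g1 g2 k z p -> ~~ common g1 g2 k z q -> ~~ common g1 g2 j z p ->
    ~~ common g1 g2 j z q -> ~~ common g1 g2 z w p -> ~~ common g1 g2 z w q ->
    (common g1 g2 w p q -> [/\ ~~ common g1 g2 k j p, ~~ common g1 g2 k j q
                             & ~~ common g1 g2 k j w]) ->
  ~~ g1 k z p.
Proof.
move=> E1 E2 /andP[kjz1 kjz2] /andP[kzw1 kzw2] /andP[zpq1 zpq2] /andP[kwp1 kwp2].
move=> /andP[kwq1 kwq2]; rewrite /common => nkzp nkzq njzp njzq nzwp nzwq inact.
apply/negP=> kzp1; rewrite kzp1 /= in nkzp.
have jzp2 : g2 j z p by swap E2 q z p k j z.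
rewrite jzp2 andbT in njzp.
have kzq2 : g2 k z q by swap E2 j k z z p q.
rewrite kzq2 andbT in nkzq.
have jzq1 : g1 j z q by swap E1 k j z z p q.
rewrite jzq1 /= in njzq.
have zwq1 : g1 z w q by swap E1 p z q k z w.
have zwp2 : g2 z w p by swap E2 q z p k z w.
rewrite zwq1 /= in nzwq; rewrite zwp2 andbT in nzwp.
have wpq1 : g1 w p q by swap E1 k w p z p q.
have wpq2 : g2 w p q by swap E2 k w q z p q.
have [] := inact; first by rewrite wpq1.
have kjp2 : g2 k j p by swap E2 w k p k j z.
have kjq1 : g1 k j q by swap E1 w k q k j z.
rewrite kjp2 kjq1 andbT /= => nkjp1 nkjq2 /negP; apply.
have -> : g1 k j w by swap E1 z k j k w p.
by swap E2 z k j k w q.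
Qed.

(** As [z] can be exchanged alone with [i], it starts serial exchanges at both [k] and [j]. If
    [z p q] were common, neither [p] nor [q] could follow [z] at [k] or [j], so the second clause of
    [stuck] for [z w] makes both adjacent to [w] at [k]. *)
Lemma engaged_not_in_common g1 g2 k i j z w p q :
    rank3_bases g1 -> rank3_bases g2 ->
    stuck g1 g2 k i j -> stuck g1 g2 j i k ->
    z \in B -> w \in B -> p \in B -> q \in B ->
  common g1 g2 k j z -> common g1 g2 k z w -> ~~ common g1 g2 z p q.
Proof.
move=> E1 E2 stk stj zB wB pB qB kjz kzw; apply/negP=> zpq.
have c12 := common_sym12 _ _ _ E1 E2; have c23 := common_sym23 _ _ _ E1 E2.
have actk : common g1 g2 k i z || common g1 g2 k j z by rewrite kjz orbT.
have actj : common g1 g2 j i z || common g1 g2 j k z by rewrite (c12 j k) kjz orbT.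
have unadj k' i' j' t u : stuck g1 g2 k' i' j' -> t \in B -> u \in B ->
    common g1 g2 k' i' z || common g1 g2 k' j' z -> common g1 g2 z t u ->
  ~~ common g1 g2 k' z t.
  move=> st tB uB act ztu; apply/negP=> kzt.
  by have [/(_ u uB)/negP] := st z t zB tB kzt act.
have zqp : common g1 g2 z q p by rewrite c23.
have [nzw adj _] := stk z w zB wB kzw actk.
have nkzp := unadj k i j p q stk pB qB actk zpq.
have nkzq := unadj k i j q p stk qB pB actk zqp.
have njzp := unadj j i k p q stj pB qB actj zpq.
have njzq := unadj j i k q p stj qB pB actj zqp.
have kwp : common g1 g2 k w p by have := adj p pB; rewrite (negbTE nkzp).
have kwq : common g1 g2 k w q by have := adj q qB; rewrite (negbTE nkzq).
have inact : common g1 g2 w p q -> [/\ ~~ common g1 g2 k j p, ~~ common g1 g2 k j q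
    & ~~ common g1 g2 k j w].
  move=> wpq.
  have H t u v : t \in B -> u \in B -> v \in B -> common g1 g2 k t u ->
      common g1 g2 t u v -> ~~ common g1 g2 k j t.
    move=> tB uB vB ktu tuv; apply/negP=> kjt.
    by have [|/(_ v vB)/negP] := stk t u tB uB ktu; rewrite ?kjt ?orbT.
  split.
  - by apply: (H p w q) => //; [rewrite c23 | rewrite c12].
  - by apply: (H q w p) => //; [rewrite c23 | rewrite c12 c23].
  - exact: (H w p q).
have := engaged_nonadjacent E1 E2 kjz kzw zpq kwp kwq nkzp nkzq njzp njzq
  (nzw p pB) (nzw q qB) inact.
have : ~~ g2 k z p.
  apply: (engaged_nonadjacent E2 E1 (j := j) (w := w) (q := q));
    by rewrite ![common g2 _ _ _ _]commonC ?nzw.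
move=> n2 n1; case/andP: kjz zpq => kjz1 kjz2 /andP[zpq1 zpq2].
(* In both matroids [p] is on the line [kz], so exchanging [j] out of [j k z] against [z p q] must
   bring in [q]. *)
case/negP: nkzq; rewrite /common.
have -> : g1 k z q by swap E1 j k z z p q.
by swap E2 j k z z p q.
Qed.

(* After contraction of k, the point r is parallel to j in the first matroid and to
   i in the second one. *)
Definition typed g1 g2 k i j r :=
  [&& g1 k i r, ~~ g1 k j r, ~~ g2 k i r & g2 k j r].

Lemma typedC g1 g2 k i j r : typed g2 g1 k i j r = typed g1 g2 k j i r.
Proof. by rewrite /typed; do 4 case: (_ k _ r). Qed.

(** After contraction of [k], the point [r] is no loop, hence not parallel to both [i] and [j] in
    either matroid. If it can be exchanged with neither, it is parallel to one in the first matroid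
    and to the other in the second. *)
Lemma inactive_typed g1 g2 k i j r s : rank3_bases g1 -> rank3_bases g2 ->
    common g1 g2 k i j -> common g1 g2 k r s ->
    ~~ common g1 g2 k i r -> ~~ common g1 g2 k j r ->
  typed g1 g2 k i j r || typed g1 g2 k j i r.
Proof.
move=> E1 E2 /andP[kij1 kij2] /andP[krs1 krs2]; rewrite /common /typed.
have : g1 k i r || g1 k j r.
  by apply/orP; swap E1 s k r k i j; [left|right]; permute E1.
have : g2 k i r || g2 k j r.
  by apply/orP; swap E2 s k r k i j; [left|right]; permute E2.
by case: (g1 k i r); case: (g1 k j r); case: (g2 k i r); case: (g2 k j r).
Qed.

(** By [stuck], [r] is adjacent at [k] to [y] or [y']; being in a common triple, it cannot be
    exchanged alone by [engaged_not_in_common]. So [inactive_typed] applies. *)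
Lemma stuck_typed g1 g2 k i j y y' r s t : rank3_bases g1 -> rank3_bases g2 ->
    common g1 g2 k i j ->
    stuck g1 g2 k i j -> stuck g1 g2 i j k -> stuck g1 g2 j i k ->
    {subset [:: y; y'; r; s; t] <= B} ->
    common g1 g2 k y y' -> common g1 g2 k i y || common g1 g2 k j y ->
    common g1 g2 r s t ->
  typed g1 g2 k i j r || typed g1 g2 k j i r.
Proof.
move=> E1 E2 kij stk sti stj sB kyy act rst.
have c12 := common_sym12 _ _ _ E1 E2; have c23 := common_sym23 _ _ _ E1 E2.
have [yB y'B rB sB' tB] : [/\ y \in B, y' \in B, r \in B, s \in B & t \in B].
  by split; apply: sB; rewrite !inE eqxx ?orbT.
have [_ /(_ r rB) adj _] := stk y y' yB y'B kyy act.
have [w wB krw] : exists2 w, w \in B & common g1 g2 k r w.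
  by case/orP: adj => h; [exists y | exists y'] => //; rewrite c23.
apply: (inactive_typed E1 E2 kij krw); apply/negP=> h.
  by have /negP := engaged_not_in_common E1 E2 (stuckC stk) sti rB wB sB' tB h krw.
by have /negP := engaged_not_in_common E1 E2 stk stj rB wB sB' tB h krw.
Qed.

(** If both had this type, [r] and [r'] would span the line [a x2] in [g1] and the line [a x1] in
    [g2]. The serial pair [y1 y2] is moved from [a] to [x1], and its position relative to these
    lines gives the contradiction. *)
Lemma stuck_same_type g1 g2 a x1 x2 y1 y2 r r' s :
    rank3_bases g1 -> rank3_bases g2 ->
    stuck g1 g2 a x1 x2 -> stuck g1 g2 x1 x2 a -> stuck g1 g2 x2 a x1 ->
    {subset [:: y1; y2; r; r'; s] <= B} ->
    common g1 g2 a x1 x2 -> common g1 g2 a x2 y1 -> common g1 g2 a y1 y2 ->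
    common g1 g2 r r' s -> typed g1 g2 a x1 x2 r ->
  ~~ typed g1 g2 a x1 x2 r'.
Proof.
move=> E1 E2 sta st1 st2 sB axx axy ayy rrs tr; apply/negP=> tr'.
have c12 := common_sym12 _ _ _ E1 E2; have c23 := common_sym23 _ _ _ E1 E2.
have [y1B y2B rB r'B sB'] : [/\ y1 \in B, y2 \in B, r \in B, r' \in B & s \in B].
  by split; apply: sB; rewrite !inE eqxx ?orbT.
have x1xa : common g1 g2 x1 x2 a by rewrite c23 c12.
have x2ax : common g1 g2 x2 a x1 by rewrite c12 c23.
have r'rs : common g1 g2 r' r s by rewrite c12.
have type_at k i j y y' : y \in B -> y' \in B ->
    stuck g1 g2 k i j -> stuck g1 g2 i j k -> stuck g1 g2 j i k ->
    common g1 g2 k i j -> common g1 g2 k y y' ->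
    common g1 g2 k i y || common g1 g2 k j y ->
    (typed g1 g2 k i j r || typed g1 g2 k j i r) /\
    (typed g1 g2 k i j r' || typed g1 g2 k j i r').
  move=> yB y'B stk sti stj kij kyy act; split.
    apply: (stuck_typed E1 E2 kij stk sti stj _ kyy act rrs).
    by move=> z; rewrite !inE => /or4P[|||/orP[]] /eqP ->.
  apply: (stuck_typed E1 E2 kij stk sti stj _ kyy act r'rs).
  by move=> z; rewrite !inE => /or4P[|||/orP[]] /eqP ->.
have [_ _ third] := sta y1 y2 y1B y2B ayy (introT orP (or_intror axy)).
have [axx1 axx2] := andP axx; have [axy1 axy2] := andP axy.
have [ayy1 ayy2] := andP ayy; have [rrs1 rrs2] := andP rrs.
have [ar1 nar1 nar2 ar2] := and4P tr; have [ar1' nar1' nar2' ar2'] := and4P tr'.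
have {third} xyy : common g1 g2 x1 y1 y2.
  (* If [x2 y1 y2] is common, the types of [r] and [r'] at [x2] put both on the line [x1 x2] of [g2]
     as well, so there both are parallel to [x1]. *)
  case/orP: third => // xyy.
  have act : common g1 g2 x2 a y1 || common g1 g2 x2 x1 y1 by rewrite (c12 x2) axy.
  have [tx tx'] := type_at _ _ _ _ _ y1B y2B st2 sta (stuckC st1) x2ax xyy act.
  have nx2 q : ~~ g1 a x2 q -> typed g1 g2 x2 a x1 q || typed g1 g2 x2 x1 a q -> ~~ g2 x2 x1 q.
    by rewrite /typed (bases_sym12 E1 a) => /negbTE -> /=; case: (g2 x2 x1 q); rewrite /= ?andbF.
  have n := nx2 r nar1 tx; have n' := nx2 r' nar1' tx'.
  by have := parallel_dependent (s := s) E2 axx2 nar2 n nar2' n'; rewrite rrs2.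
have [xyy1 xyy2] := andP xyy.
(* In the same way, a serial exchange at [x1] would make [r] and [r'] parallel to [x2] in [g1].
   Hence [y1] and [y2] are typed at [x1]. *)
have inact y y' : y \in B -> y' \in B -> common g1 g2 x1 y y' ->
    ~~ (common g1 g2 x1 x2 y || common g1 g2 x1 a y).
  move=> yB y'B xy; apply/negP=> act.
  have [tx tx'] := type_at _ _ _ _ _ yB y'B st1 st2 (stuckC sta) x1xa xy act.
  have nx1 q : ~~ g2 a x1 q -> typed g1 g2 x1 x2 a q || typed g1 g2 x1 a x2 q -> ~~ g1 x1 x2 q.
    by rewrite /typed (bases_sym12 E2 a) => /negbTE ->; case: (g1 x1 x2 q); rewrite /= ?andbF.
  have n := nx1 r nar2 tx; have n' := nx1 r' nar2' tx'.
  have axx1' : g1 a x2 x1 by permute E1.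
  by have := parallel_dependent (s := s) E1 axx1' nar1 n nar1' n'; rewrite rrs1.
have xyy' : common g1 g2 x1 y2 y1 by rewrite c23.
have t1 : typed g1 g2 x1 x2 a y1 || typed g1 g2 x1 a x2 y1.
  have := inact y1 y2 y1B y2B xyy; rewrite negb_or => /andP[].
  exact: inactive_typed xyy.
have t2 : typed g1 g2 x1 x2 a y2 || typed g1 g2 x1 a x2 y2.
  have := inact y2 y1 y2B y1B xyy'; rewrite negb_or => /andP[].
  exact: inactive_typed xyy'.
have [x1xa1 x1xa2] := andP x1xa.
(* With the other type, [y1] would be off both lines spanned by [r] and [r'], so [y1 r r'] would be
   common although [y1] can be exchanged alone. *)
have {t1} /and4P[xay1 nxy1 nxay2 xxy2] : typed g1 g2 x1 a x2 y1.
  case/orP: t1 => // /and4P[xxy1 nxay1 nxxy2 xay2].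
  have axy2' : g2 a x1 y1 by permute E2.
  have yrr : common g1 g2 y1 r r'.
    by rewrite /common (line_bases E1 axy1 nar1 nar1' rrs1) (line_bases E2 axy2' nar2 nar2' rrs2).
  by have /negP := engaged_not_in_common E1 E2 sta (stuckC st2) y1B y2B rB r'B axy ayy.
(* If [y2] had the type of [y1], then [x1], [y1], [y2] would all lie on the line [x1 x2] of [g1]. *)
have {t2} /and4P[xxy1' nxay1' nxxy2' xay2'] : typed g1 g2 x1 x2 a y2.
  case/orP: t2 => // /and4P[_ nxxy1' _ _].
  by exfalso; swap E1 a x1 x2 x1 y1 y2.
have [nyyr _ _] := sta y1 y2 y1B y2B ayy (introT orP (or_intror axy)).
have arr1 : ~~ g1 a r r' := line_dependent E1 axy1 nar1 nar1'.
have axy2' : g2 a x1 y2 by permute E2.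
have arr2 : ~~ g2 a r r' := line_dependent E2 axy2' nar2 nar2'.
(* If [u] is off the line [y1 y2] in [g1], then [u'] is off it in [g2] but on it in [g1]. This makes
   [y1 u'] a serial pair at [x2], and [stuck] demands that [u] be adjacent to [y1] or [u'] there.
   The first fails in [g2], where [a], [x1], [y1], [u] are collinear; the second fails in [g1],
   where [a], [x2], [u], [u'] are. *)
have yyu u u' v : u \in B -> u' \in B -> common g1 g2 u u' v ->
    typed g1 g2 a x1 x2 u -> typed g1 g2 a x1 x2 u' -> ~~ g1 y1 y2 u.
  move=> uB u'B /andP[uuv1 uuv2] /and4P[_ nau1 nau2 _] /and4P[_ nau1' nau2' _].
  apply/negP=> yyu1.
  have nyyu2 : ~~ g2 y1 y2 u by have := nyyr u uB; rewrite /common yyu1.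
  have yuu2 := line_bases E2 axy2' nau2 nau2' uuv2.
  have yyu2 : g2 y1 y2 u' by swap E2 a y1 y2 y2 u u'.
  have nyyu1 : ~~ g1 y1 y2 u' by have := nyyr u' u'B; rewrite /common yyu2 andbT.
  have yuu1 := line_bases E1 axy1 nau1 nau1' uuv1.
  have xyy1' : g1 x2 y1 y2 by swap E1 a x2 y1 x1 x2 y2.
  have nxay2' : ~~ g2 a x1 y1 by rewrite (bases_sym12 E2).
  have nxau2' q : ~~ g2 a x1 q -> ~~ g2 x1 a q by rewrite (bases_sym12 E2).
  have nxyu2 q : ~~ g2 a x1 q -> ~~ g2 x1 y1 q.
    by move=> /nxau2'; apply: (line_dependent E2 xay2' nxay2).
  have nayu2 q : ~~ g2 a x1 q -> ~~ g2 a y1 q.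
    exact: (line_dependent E2 axy2' nxay2').
  have xyu : common g1 g2 x2 y1 u'.
    apply/andP; split; first by swap E1 u y1 u' x2 y1 y2.
    have n := nxyu2 u' nau2'; have n' := nayu2 u' nau2'.
    by swap E2 y2 y1 u' x1 a x2.
  have act : common g1 g2 x2 a y1 || common g1 g2 x2 x1 y1 by rewrite (c12 x2) axy.
  have [_ /(_ u uB) /orP[]/andP[h1 h2] _] := st2 y1 u' y1B u'B xyu act.
    have n := nxyu2 u nau2; have n' := nayu2 u nau2.
    by swap E2 x2 y1 u x1 a y2.
  have xay1' : g1 x2 a y1 by permute E1.
  have nxau1 : ~~ g1 x2 a u by rewrite (bases_sym12 E1).
  have nxau1' : ~~ g1 x2 a u' by rewrite (bases_sym12 E1).
  by have /negP := line_dependent E1 xay1' nxau1' nxau1.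
(* Now [r] and [r'] span the line [y1 y2] of [g1], which misses [a]; yet they are collinear with
   [a]. *)
have yya1 : g1 y1 y2 a by permute E1.
have /negP := line_dependent E1 axy1 nar1 nar1'; apply.
have nyyr1 := yyu _ _ _ rB r'B rrs tr tr'; have nyyr1' := yyu _ _ _ r'B rB r'rs tr' tr.
exact: (line_bases E1 yya1 nyyr1 nyyr1' rrs1).
Qed.

(** Each of the three points has one of two types, so two of them share a type. Interchanging the
    matroids interchanges the types, so [stuck_same_type] excludes both cases. *)
Lemma stuck_no_common_triple g1 g2 a x1 x2 y1 y2 r s t :
    rank3_bases g1 -> rank3_bases g2 ->
    stuck g1 g2 a x1 x2 -> stuck g1 g2 x1 x2 a -> stuck g1 g2 x2 a x1 ->
    {subset [:: y1; y2; r; s; t] <= B} ->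
    common g1 g2 a x1 x2 -> common g1 g2 a x2 y1 -> common g1 g2 a y1 y2 ->
  ~~ common g1 g2 r s t.
Proof.
move=> E1 E2 sta st1 st2 sB axx axy ayy; apply/negP=> rst.
have c12 := common_sym12 _ _ _ E1 E2; have c23 := common_sym23 _ _ _ E1 E2.
have [y1B y2B rB sB' tB] : [/\ y1 \in B, y2 \in B, r \in B, s \in B & t \in B].
  by split; apply: sB; rewrite !inE eqxx ?orbT.
have one_type p q o : p \in B -> q \in B -> o \in B -> common g1 g2 p q o ->
    (typed g1 g2 a x1 x2 p -> ~~ typed g1 g2 a x1 x2 q) /\
    (typed g1 g2 a x2 x1 p -> ~~ typed g1 g2 a x2 x1 q).
  move=> pB qB oB pqo.
  have sB0 : {subset [:: y1; y2; p; q; o] <= B}.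
    by move=> z; rewrite !inE => /or4P[|||/orP[]] /eqP ->.
  split; first exact: (stuck_same_type E1 E2 sta st1 st2 sB0).
  rewrite -!(typedC g1).
  apply: (stuck_same_type E2 E1 (stuck_swap sta) (stuck_swap st1) (stuck_swap st2) sB0);
    by rewrite ?[common g2 _ _ _ _]commonC // ?[common g1 _ _ _ _]commonC.
have act : common g1 g2 a x1 y1 || common g1 g2 a x2 y1 by rewrite axy orbT.
have type_of p q o : p \in B -> q \in B -> o \in B -> common g1 g2 p q o ->
    typed g1 g2 a x1 x2 p || typed g1 g2 a x2 x1 p.
  move=> pB qB oB pqo.
  apply: (stuck_typed E1 E2 axx sta st1 (stuckC st2) _ ayy act pqo).
  by move=> z; rewrite !inE => /or4P[|||/orP[]] /eqP ->.
have srt : common g1 g2 s r t by rewrite c12.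
have str : common g1 g2 s t r by rewrite c23.
have trs : common g1 g2 t r s by rewrite c12 c23 c12 c23.
have rts : common g1 g2 r t s by rewrite c12.
have [rs1 rs2] := one_type r s t rB sB' tB rst.
have [st1' st2'] := one_type s t r sB' tB rB str.
have [rt1 rt2] := one_type r t s rB tB sB' rts.
have := type_of t r s tB rB sB' trs; have := type_of s r t sB' rB tB srt.
have := type_of r s t rB sB' tB rst.
move: rs1 rs2 st1' st2' rt1 rt2.
by do 6 case: (typed _ _ _ _ _ _) => //=; move=> *; auto.
Qed.
(** After contraction of [k], [b] is parallel to neither [i] nor [j], while [r] is parallel to one
    of them in each matroid. *)
Lemma typed_adjacent g1 g2 k i j b r : rank3_bases g1 -> rank3_bases g2 ->
    common g1 g2 k i b -> common g1 g2 k j b ->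
  typed g1 g2 k i j r -> common g1 g2 k b r.
Proof.
move=> E1 E2 /andP[kib1 kib2] /andP[kjb1 kjb2] /and4P[kir nkjr nkir kjr].
by apply/andP; split; [swap E1 i k r k j b | swap E2 j k r k i b].
Qed.

End TwoMatroids.

Ltac decide_mem z :=
  repeat (match goal with |- context [z == ?v] => case: (eqVneq z v) => [?|?]; [subst z|] end);
  repeat match goal with
    | H : is_true (?v \in ?S) |- context [?v \in ?S] => rewrite H
    | H : is_true (?v \notin ?S) |- context [?v \in ?S] => rewrite (negbTE H)
    | H : is_true (?v != ?w) |- context [?v == ?w] => rewrite (negbTE H)
    | H : is_true (?w != ?v) |- context [?v == ?w] => rewrite (eq_sym v w) (negbTE H)
    | |- context [?v == ?v] => rewrite eqxx
  end;
  rewrite /= ?orbT ?andbT ?orbF ?andbF //=.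

(** * The rank-3 matroids of a triple *)

Section Exchange.
Variables (T : finType) (M : matroid T).
Implicit Types (A B C D : {set T}) (e f p q r s t u x y : T).

Lemma basis_exchange A B e : basis M A -> basis M B -> e \in A -> e \notin B ->
  exists f, [/\ f \in B, f \notin A, basis M (f |: (A :\ e))
              & basis M (e |: (B :\ f))].
Proof.
move=> bA bB eA eB.
have eXA : [set e] \subset A by rewrite sub1set.
have [Y [YB /eqP]] := multiple_symmetric_exchange bA bB eXA.
rewrite cards1 => /cards1P[f Yf]; rewrite Yf sub1set ![_ :|: [set _]]setUC in YB * => bA' bB'.
(* If [f] were in [A], the new basis would be smaller than [A] unless [f] is [e], and [e] is not in
   [B]. *)
exists f; split=> //; apply/negP=> fA.
have := card_basis bA bA'; rewrite (cardsD1 e A) eA cardsU1 !inE fA andbT negbK.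
case: (eqVneq f e) => [fe|_] /=; last by lia.
by rewrite -fe YB in eB.
Qed.

Lemma card_add3 C p q r : #|C :|: [set p; q; r]| = #|C| + 3 ->
  [/\ p \notin C, q \notin C, r \notin C & [/\ p != q, p != r & q != r]].
Proof.
have -> : C :|: [set p; q; r] = p |: (q |: (r |: C)).
  by apply/setP=> z; rewrite !inE; case: (z \in C); rewrite ?orbT // orbF -orbA.
rewrite !cardsU1 !inE !negb_or.
case: (p \in C); first by rewrite /= !andbF; case: (_ && _); case: (r \in C); lia.
case: (p != q) => /=; last by case: (_ && _); case: (r \in C); lia.
case: (p != r) => /=; last by case: (_ && _); case: (r \in C); lia.
case: (q != r) => /=; last by case: (r \in C); lia.
by case: (q \in C); case: (r \in C) => //=; lia.
Qed.

Lemma card_del3 D p q r : #|D :\: [set p; q; r]| + 3 = #|D| ->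
  [/\ p \in D, q \in D, r \in D & [/\ p != q, p != r & q != r]].
Proof.
have -> : D :\: [set p; q; r] = D :\ p :\ q :\ r.
  by apply/setP=> z; rewrite !inE !negb_or -!andbA; do 3 case: (z == _).
rewrite (cardsD1 p D) (cardsD1 q (D :\ p)) (cardsD1 r (D :\ p :\ q)) !inE.
rewrite ![_ == p]eq_sym [r == q]eq_sym.
case: (p \in D) => /=; last by case: (_ && _); case: (_ && _); lia.
case: (p != q) => /=; last by case: (_ && _); lia.
case: (q \in D) => /=; last by case: (_ && _); lia.
by case: (p != r); case: (q != r); case: (r \in D) => //=; lia.
Qed.

Lemma rank3_bases_add A C : basis M A -> #|A| = #|C| + 3 ->
  rank3_bases (fun p q r => basis M (C :|: [set p; q; r])).
Proof.
move=> bA cA; split=> [p q r|p q r|p r|p q r s t u].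
- by rewrite (setUC [set p] [set q]).
- by rewrite -!setUA (setUC [set q] [set r]).
- apply/negP=> b; have := card_basis bA b; rewrite cA => /esym/card_add3[_ _ _ []].
  by rewrite eqxx.
move=> b1 b2; have [pI|pI] := boolP (p \in [set s; t; u]).
  move: pI; rewrite !inE -orbA => /or3P[]/eqP <-;
    by [apply: Or31 | apply: Or32 | apply: Or33].
have := card_basis bA b1; rewrite cA => /esym/card_add3[pC qC rC [pq pr qr]].
have p1 : p \in C :|: [set p; q; r] by rewrite !inE eqxx orbT.
have p2 : p \notin C :|: [set s; t; u] by rewrite inE negb_or pC.
have [f [f2 f1 b _]] := basis_exchange b1 b2 p1 p2.
have e : f |: (C :|: [set p; q; r]) :\ p = C :|: [set f; q; r].
  by apply/setP=> z; rewrite !inE; decide_mem z.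
rewrite e in b; move: f2 f1; rewrite !inE !negb_or => f2 /andP[fC _].
rewrite (negbTE fC) /= -orbA in f2.
by case/or3P: f2 b => /eqP ->; [apply: Or31 | apply: Or32 | apply: Or33].
Qed.

Lemma rank3_bases_del A D : basis M A -> #|A| + 3 = #|D| ->
  rank3_bases (fun p q r => basis M (D :\: [set p; q; r])).
Proof.
move=> bA cA; split=> [p q r|p q r|p r|p q r s t u].
- by rewrite (setUC [set p] [set q]).
- by rewrite -!setUA (setUC [set q] [set r]).
- apply/negP=> b; have := card_basis bA b; move: cA => /[swap] -> /card_del3[_ _ _ []].
  by rewrite eqxx.
move=> b1 b2; have [pI|pI] := boolP (p \in [set s; t; u]).
  move: pI; rewrite !inE -orbA => /or3P[]/eqP <-;
    by [apply: Or31 | apply: Or32 | apply: Or33].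
have := card_basis bA b1; move: cA => /[swap] -> /card_del3[pD qD rD [pq pr qr]].
have p1 : p \notin D :\: [set p; q; r] by rewrite !inE eqxx.
have p2 : p \in D :\: [set s; t; u] by rewrite inE pI.
have [f [f1 f2 _ b]] := basis_exchange b2 b1 p2 p1.
move: f1 f2; rewrite !inE !negb_or => /andP[/andP[/andP[fp fq] fr] fD].
rewrite fD andbT !negb_and !negbK -orbA => f2.
have e : p |: (D :\: [set p; q; r]) :\ f = D :\: [set f; q; r].
  by apply/setP=> z; rewrite !inE; decide_mem z.
rewrite e in b.
by case/or3P: f2 b => /eqP ->; [apply: Or31 | apply: Or32 | apply: Or33].
Qed.
End Exchange.

(** * Serial exchanges *)

Section Serial.
Variables (T : finType) (M : matroid T) (A B : {set T}).
Hypotheses (bA : basis M A) (bB : basis M B) (disjAB : [disjoint A & B]).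
Implicit Types (X Y C D S : {set T}) (a b i j k p q r x y z : T).

Definition exchangeable X Y :=
  basis M ((A :\: X) :|: Y) && basis M ((B :\: Y) :|: X).

Definition no_serial3 := forall a1 a2 a3 b1 b2 b3,
  uniq [:: a1; a2; a3] -> uniq [:: b1; b2; b3] ->
  {subset [:: a1; a2; a3] <= A} -> {subset [:: b1; b2; b3] <= B} ->
  exchangeable [set a1] [set b1] -> exchangeable [set a1; a2] [set b1; b2] ->
  ~~ exchangeable [set a1; a2; a3] [set b1; b2; b3].

(* For a triple X of A and a triple S of X + B, the second condition says that the
   complement of (A \ X) + S in A + B is a basis. *)
Definition common_bases X :=
  common (fun p q r => basis M ((A :\: X) :|: [set p; q; r]))
         (fun p q r => basis M ((B :|: X) :\: [set p; q; r])).

Lemma memA_notinB x : x \in A -> x \notin B.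
Proof. by move=> xA; rewrite (disjointFr disjAB). Qed.

Lemma memB_notinA x : x \in B -> x \notin A.
Proof. by move=> xB; rewrite (disjointFl disjAB). Qed.

Lemma memAB_neq x y : x \in A -> y \in B -> x != y.
Proof. by move=> xA; apply: contraTneq => <-; apply: memA_notinB. Qed.

Ltac decide_sets :=
  let z := fresh "z" in apply/setP=> z; rewrite !inE;
  repeat (match goal with |- context [z == ?v] => case: (eqVneq z v) => [?|?]; [subst z|] end);
  repeat match goal with
    | H : is_true (?v \in _) |- context [?v \in _] =>
        first [ rewrite H | rewrite (negbTE (memA_notinB H)) | rewrite (negbTE (memB_notinA H)) ]
    | H : is_true (?v != ?w) |- context [?v == ?w] => rewrite (negbTE H)
    | H : is_true (?w != ?v) |- context [?v == ?w] => rewrite (eq_sym v w) (negbTE H)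
    | H : is_true (?v \in _), K : is_true (?w \in _) |- context [?v == ?w] =>
        first [ rewrite (negbTE (memAB_neq H K))
              | rewrite (eq_sym v w) (negbTE (memAB_neq K H)) ]
    | |- context [?v == ?v] => rewrite eqxx
  end;
  rewrite /= ?orbT ?andbT ?orbF ?andbF //=.

Lemma eq_basis S S' : S = S' -> basis M S -> basis M S'.
Proof. by move=> ->. Qed.

Section Triple.
Variables (X : {set T}) (i j k : T).
Hypotheses (iA : i \in A) (jA : j \in A) (kA : k \in A).
Hypotheses (ij : i != j) (ik : i != k) (jk : j != k) (defX : X = [set i; j; k]).

Local Notation c := (common_bases X).

Lemma common_basesE1 p : p \in B -> c k i p = exchangeable [set j] [set p].
Proof.
move=> pB; rewrite /common_bases /common /exchangeable defX /=.
by congr (_ && _); congr (basis M _); decide_sets.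
Qed.

Lemma common_basesE2 p q : p \in B -> q \in B ->
  c k p q = exchangeable [set j; i] [set p; q].
Proof.
move=> pB qB; rewrite /common_bases /common /exchangeable defX /=.
by congr (_ && _); congr (basis M _); decide_sets.
Qed.

Lemma common_basesE3 p q r : p \in B -> q \in B -> r \in B ->
  c p q r = exchangeable [set j; i; k] [set p; q; r].
Proof.
move=> pB qB rB; rewrite /common_bases /common /exchangeable defX /=.
by congr (_ && _); congr (basis M _); decide_sets.
Qed.

Lemma card_X : X \subset A /\ #|X| = 3.
Proof.
split; first by rewrite defX !subUset !sub1set iA jA kA.
by rewrite defX -setUA cardsU1 cards2 !inE negb_or ij ik jk.
Qed.

Lemma card_triple : #|A| = #|A :\: X| + 3.
Proof. by have [XA cX] := card_X; rewrite -(cardsID X A) (setIidPr XA) cX addnC. Qed.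

Lemma card_cotriple : #|A| + 3 = #|B :|: X|.
Proof.
have [XA cX] := card_X.
have disjBX : [disjoint B & X] by rewrite disjoint_sym (disjointWl XA).
by rewrite cardsU (disjoint_setI0 disjBX) cards0 subn0 -(card_basis bA bB) cX.
Qed.

(** The serial exchange is [j] with [p], then [i] with [q]. A symmetric exchange of [r] or of [k]
    between the two resulting bases either undoes part of these steps, giving a listed alternative,
    or is a forbidden third step. *)
Lemma stuck_common_bases_ordered p q : no_serial3 -> p \in B -> q \in B ->
    c k p q -> c k i p ->
  [/\ forall r, r \in B -> ~~ c p q r,
      forall r, r \in B -> c k p r || c k q r & c i p q || c j p q].
Proof.
move=> ns pB qB kpq kip.
have E1 := rank3_bases_add bA card_triple; have E2 := rank3_bases_del bA card_cotriple.
have c12 x y z : c x y z = c y x z := common_sym12 x y z E1 E2.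
have c23 x y z : c x y z = c x z y := common_sym23 x y z E1 E2.
have neq x y z : c x y z -> [/\ x != y, x != z & y != z].
  have diag u v : c u u v = false by rewrite /common_bases /common (bases_diag E1).
  move=> xyz; split; apply: contraTneq xyz => ->; first by rewrite diag.
  - by rewrite c23 diag.
  - by rewrite c12 c23 diag.
have no_triple r : r \in B -> ~~ c p q r.
  move=> rB; apply/negP=> pqr; have [pq pr qr] := neq _ _ _ pqr.
  suff /negP : ~~ exchangeable [set j; i; k] [set p; q; r] by rewrite -common_basesE3.
  apply: ns.
  - by rewrite /= !inE negb_or eq_sym ij jk ik.
  - by rewrite /= !inE negb_or pq pr qr.
  - by move=> z; rewrite !inE => /or3P[]/eqP ->.
  - by move=> z; rewrite !inE => /or3P[]/eqP ->.
  - by rewrite -common_basesE1.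
  - by rewrite -common_basesE2.
have [pk kq pq] := neq _ _ _ kpq.
have [bP bQ] := andP kpq; rewrite /= in bP bQ.
split=> // [r rB|].
  case: (eqVneq r p) => [->|rp]; first by rewrite [c k q p]c23 kpq orbT.
  case: (eqVneq r q) => [->|rq]; first by rewrite kpq.
  have rk : r != k by rewrite eq_sym memAB_neq.
  have rQ : r \in (B :|: X) :\: [set k; p; q].
    by rewrite !inE rB (negbTE rp) (negbTE rq) (negbTE rk).
  have rP : r \notin (A :\: X) :|: [set k; p; q].
    by rewrite !inE (negbTE rp) (negbTE rq) (negbTE rk) (negbTE (memB_notinA rB)) andbF.
  have [f [fP fQ bQ' bP']] := basis_exchange bQ bP rQ rP.
  case: (eqVneq f p) => [fp|fp].
    apply/orP; right; apply/andP; split; [apply: eq_basis bP' | apply: eq_basis bQ'];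
      by rewrite fp defX; decide_sets.
  case: (eqVneq f q) => [fq|fq].
    apply/orP; left; apply/andP; split; [apply: eq_basis bP' | apply: eq_basis bQ'];
      by rewrite fq defX; decide_sets.
  case: (eqVneq f k) => [fk|fk].
    have /negP[] := no_triple r rB; apply/andP; split; [apply: eq_basis bP' | apply: eq_basis bQ'];
      by rewrite fk defX; decide_sets.
  (* The remaining partner [f] is in [A] outside [X], and exchanging it with [r] is a third step;
     this is why [no_serial3] ranges over all triples of [A]. *)
  move: fP; rewrite !inE (negbTE fp) (negbTE fq) (negbTE fk) !orbF => /andP[fX fA].
  move: fX; rewrite defX !inE !negb_or => /andP[/andP[fi fj] _].
  suff /negP[] : ~~ exchangeable [set j; i; f] [set p; q; r].
    apply/andP; split; [apply: eq_basis bP' | apply: eq_basis bQ'];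
      by rewrite defX; decide_sets.
  apply: ns.
  - by rewrite /= !inE negb_or eq_sym ij (eq_sym j) fj eq_sym fi.
  - by rewrite /= !inE negb_or pq ![_ == r]eq_sym rp rq.
  - by move=> z; rewrite !inE => /or3P[]/eqP ->.
  - by move=> z; rewrite !inE => /or3P[]/eqP ->.
  - by rewrite -common_basesE1.
  - by rewrite -common_basesE2.
have kP : k \in (A :\: X) :|: [set k; p; q] by rewrite !inE eqxx orbT.
have kQ : k \notin (B :|: X) :\: [set k; p; q] by rewrite !inE eqxx.
have [f [fQ fP bP' bQ']] := basis_exchange bP bQ kP kQ.
move: fQ; rewrite !inE !negb_or => /andP[/andP[/andP[fk fp] fq] fBX].
case/orP: fBX => [fB|].
  have /negP[] := no_triple f fB; apply/andP; split; [apply: eq_basis bP' | apply: eq_basis bQ'];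
    by rewrite defX; decide_sets.
rewrite defX !inE (negbTE fk) orbF => /orP[]/eqP fE; apply/orP; [left | right];
  apply/andP; split; [apply: eq_basis bP' | apply: eq_basis bQ' | apply: eq_basis bP' | apply: eq_basis bQ'];
  by rewrite fE defX; decide_sets.
Qed.
End Triple.

Lemma stuck_common_bases X i j k : no_serial3 -> i \in A -> j \in A -> k \in A ->
    i != j -> i != k -> j != k -> X = [set i; j; k] ->
  stuck B (fun p q r => basis M ((A :\: X) :|: [set p; q; r]))
          (fun p q r => basis M ((B :|: X) :\: [set p; q; r])) k i j.
Proof.
move=> ns iA jA kA ij ik jk defX p q pB qB kpq /orP[kip|kjp].
  exact: (stuck_common_bases_ordered iA jA kA ij ik jk defX ns pB qB kpq kip).
have ji : j != i by rewrite eq_sym.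
have defX' : X = [set j; i; k] by rewrite defX (setUC [set i]).
have [h1 h2 h3] := stuck_common_bases_ordered jA iA kA ji jk ik defX' ns pB qB kpq kjp.
by split=> //; rewrite orbC.
Qed.

Lemma serial_pair x1 x2 a : x1 \in A -> x2 \in A -> a \in A ->
    x1 != x2 -> x1 != a -> x2 != a ->
  let c := common_bases [set x1; x2; a] in
  exists y1 y2, [/\ y1 \in B, y2 \in B, c a x1 y1 || c a x2 y1 & c a y1 y2].
Proof.
move=> x1A x2A aA x12 x1a x2a c.
have E1 := rank3_bases_add bA (card_triple x1A x2A aA x12 x1a x2a (erefl _)).
have E2 := rank3_bases_del bA (card_cotriple x1A x2A aA x12 x1a x2a (erefl _)).
have c12 x y z : c x y z = c y x z := common_sym12 x y z E1 E2.
have c23 x y z : c x y z = c x z y := common_sym23 x y z E1 E2.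
have [b [bB' _ bA1 bB1]] := basis_exchange bA bB x1A (memA_notinB x1A).
have axb : c a x2 b.
  apply/andP; split; [apply: eq_basis bA1 | apply: eq_basis bB1]; decide_sets.
have x2A1 : x2 \in b |: (A :\ x1) by rewrite !inE x2A (eq_sym x2 x1) x12 orbT.
have x2B1 : x2 \notin x1 |: (B :\ b).
  by rewrite !inE (negbTE (memA_notinB x2A)) andbF orbF eq_sym (negbTE x12).
have [f [fB1 fA1 bA2 bB2]] := basis_exchange bA1 bB1 x2A1 x2B1.
(* A partner [f] in [B] completes the pair. If the partner is [x1], then [b] can be exchanged alone
   with either [x1] or [x2]. *)
move: fB1; rewrite !inE => /orP[/eqP fx|/andP[fb fB]]; last first.
  exists b, f; rewrite axb orbT; split=> //.
  apply/andP; split; [apply: eq_basis bA2 | apply: eq_basis bB2]; decide_sets.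
have axb' : c a x1 b.
  apply/andP; split; [apply: eq_basis bA2 | apply: eq_basis bB2]; rewrite fx; decide_sets.
have xxA : [set x1; x2] \subset A by rewrite subUset !sub1set x1A.
have [Y [YB /eqP cY bA3 bB3]] := multiple_symmetric_exchange bA bB xxA.
move: cY; rewrite cards2 x12 => /cards2P[y1 [y2 [y12 defY]]].
have [y1B y2B] : y1 \in B /\ y2 \in B by split; apply: (subsetP YB); rewrite defY !inE eqxx ?orbT.
have ayy : c a y1 y2.
  apply/andP; split; [apply: eq_basis bA3 | apply: eq_basis bB3]; rewrite defY; decide_sets.
have [act|] := boolP (c a x1 y1 || c a x2 y1); first by exists y1, y2.
(* If [y1] cannot be exchanged alone, it is typed, hence adjacent to [b], which serves as the first
   step. *)
rewrite negb_or => /andP[n1 n2]; exists b, y1; rewrite axb orbT; split=> //.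
have axx : c a x1 x2.
  apply/andP; split; [apply: eq_basis bA | apply: eq_basis bB]; decide_sets.
case/orP: (inactive_typed E1 E2 axx ayy n1 n2).
  exact: (typed_adjacent E1 E2 axb' axb).
exact: (typed_adjacent E1 E2 axb axb').
Qed.

Lemma serial3_exists : 2 < #|A| -> ~ no_serial3.
Proof.
move=> /card_gt2P[x1 [x2 [a [[x1A x2A aA] [x12 x2a ax1]]]]] ns.
have x1a : x1 != a by rewrite eq_sym.
have x21 : x2 != x1 by rewrite eq_sym.
have ax2 : a != x2 by rewrite eq_sym.
pose X := [set x1; x2; a].
have X2 : X = [set x2; a; x1] by rewrite /X -setUA setUC.
have X3 : X = [set a; x1; x2] by rewrite /X setUC setUA.
have E1 := rank3_bases_add bA (card_triple x1A x2A aA x12 x1a x2a (erefl _)).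
have E2 := rank3_bases_del bA (card_cotriple x1A x2A aA x12 x1a x2a (erefl _)).
have [XA cX] := card_X x1A x2A aA x12 x1a x2a (erefl X).
have [Y [YB cY bA' bB']] := multiple_symmetric_exchange bA bB XA.
have [r [s [t [[rY sY tY] [rs st tr]]]]] : exists r s t,
    [/\ r \in Y, s \in Y & t \in Y] /\ [/\ r != s, s != t & t != r].
  by apply/card_gt2P; rewrite cY cX.
have defY : Y = [set r; s; t].
  apply/eqP; rewrite eq_sym eqEcard !subUset !sub1set rY sY tY cY cX.
  by rewrite -setUA cardsU1 cards2 !inE negb_or rs st eq_sym tr.
have [rB sB tB] : [/\ r \in B, s \in B & t \in B] by split; apply: (subsetP YB).
have rst : common_bases X r s t.
  apply/andP; split; first by rewrite -defY.
  by apply: eq_basis bB'; rewrite defY /X; decide_sets.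
have axx : common_bases X a x1 x2.
  apply/andP; split; [apply: eq_basis bA | apply: eq_basis bB]; rewrite /X; decide_sets.
have axx' : common_bases X a x2 x1.
  apply/andP; split; [apply: eq_basis bA | apply: eq_basis bB]; rewrite /X; decide_sets.
have sta := stuck_common_bases ns x1A x2A aA x12 x1a x2a (erefl X).
have st1 := stuck_common_bases ns x2A aA x1A x2a x21 ax1 X2.
have st2 := stuck_common_bases ns aA x1A x2A ax1 ax2 x12 X3.
have [y1 [y2 [y1B y2B act ayy]]] := serial_pair x1A x2A aA x12 x1a x2a.
have sub : {subset [:: y1; y2; r; s; t] <= B}.
  by move=> z; rewrite !inE => /or4P[|||/orP[]] /eqP ->.
(* The first exchanged element of [A] may be [x2] or [x1]; the former case is the latter with the
   names interchanged. *)
case/orP: act => axy.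
  have /negP := stuck_no_common_triple E1 E2 (stuckC sta) (stuckC st2) (stuckC st1) sub axx' axy ayy.
  by apply.
have /negP := stuck_no_common_triple E1 E2 sta st1 st2 sub axx axy ayy.
by apply.
Qed.
End Serial.

(** * Passage from triples to functions on ['I_3] *)

Lemma imset_nth_leq (T : finType) (x : T) (s : seq T) (i : 'I_3) : size s = 3 ->
  [set nth x s j | j : 'I_3 & j <= i] = [set u in take i.+1 s].
Proof.
move=> s3; have i3 := ltn_ord i; apply/setP=> u; apply/imsetP/idP.
  move=> [j]; rewrite inE => ji ->; rewrite inE -(nth_take x (n0 := i.+1)) //.
  by rewrite mem_nth // size_takel ?s3.
rewrite inE => /(nthP x)[j]; rewrite size_takel ?s3 // => ji <-.
exists (Ordinal (leq_trans ji i3)); first by rewrite inE.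
by rewrite nth_take.
Qed.

Theorem theorem3p4 (T : finType) (M : matroid T) (A B : {set T})
  (basisA : basis M A) (basisB : basis M B) (disjAB : [disjoint A & B])
  (rank_ge3 : 3 <= #|A|) :
  exists (a b : 'I_3 -> T),
    [/\ injective a,
        injective b,
        forall i, a i \in A,
        forall i, b i \in B
      & forall i : 'I_3,
          basis M ((A :\: [set a j | j : 'I_3 & j <= i])
                     :|: [set b j | j : 'I_3 & j <= i])
          /\ basis M ((B :\: [set b j | j : 'I_3 & j <= i])
                     :|: [set a j | j : 'I_3 & j <= i])].
Proof.
(* Encoding the exchanges by tuples makes their existence decidable. Indices start at 0, so stage
   [i] uses the first [i.+1] entries. *)
pose serial (s t : 3.-tuple T) := [&& uniq s, uniq t, all (mem A) s, all (mem B) t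
  & [forall i : 'I_3, exchangeable M A B [set u in take i.+1 s] [set u in take i.+1 t]]].
have [/existsP[s /existsP[t /and5P[us ut sA tB /forallP st]]]|no_serial] :=
  boolP [exists s, exists t, serial s t].
  have inj (u : 3.-tuple T) : uniq u -> injective (tnth u).
    by move=> /tuple_uniqP.
  exists (tnth s), (tnth t); split.
  - exact: inj.
  - exact: inj.
  - by move=> i; apply: (allP sA); apply: mem_tnth.
  - by move=> i; apply: (allP tB); apply: mem_tnth.
  move=> i; have x := tnth s i.
  have E (u : 3.-tuple T) : [set tnth u j | j : 'I_3 & j <= i] = [set v in take i.+1 u].
    rewrite -(imset_nth_leq x) ?size_tuple //.
    by apply: eq_imset => j; rewrite (tnth_nth x).
  by rewrite !E; apply/andP; apply: st.
case: (serial3_exists basisA basisB disjAB rank_ge3).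
move=> a1 a2 a3 b1 b2 b3 ua ub aA bB e1 e2; apply/negP=> e3.
case/negP: no_serial; apply/existsP; exists [tuple a1; a2; a3].
apply/existsP; exists [tuple b1; b2; b3]; rewrite /serial ua ub /=.
rewrite !aA ?bB ?inE ?eqxx ?orbT //=.
have E1 (x : T) : [set u in [:: x]] = [set x] by apply/setP=> u; rewrite !inE.
have E2 (x y : T) : [set u in [:: x; y]] = [set x; y] by apply/setP=> u; rewrite !inE.
have E3 (x y z : T) : [set u in [:: x; y; z]] = [set x; y; z].
  by apply/setP=> u; rewrite !inE orbA.
by apply/forallP=> -[[|[|[|//]]] ilt]; rewrite /= ?E3 ?E2 ?E1.
Qed.
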